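(* Let $\omega\in\mathbb{R}\setminus\mathbb{Q}$, let $\mathbb{I}=[a,b]$ with $a<b$, and let $\Omega=\mathbb{S}^1\times\mathbb{I}$. There exists a map $T\in\mathcal{S}(\Omega)$, $T(\theta,x)=(R_\omega(\theta),f(\theta,x))$, such that $f(\theta,\cdot)$ is non-increasing for every $\theta\in\mathbb{S}^1$, $T$ permutes the upper and lower circles of $\Omega$ (that is, $f(\theta,b)=a$ and $f(\theta,a)=b$ for every $\theta\in\mathbb{S}^1$, so that $T$ has a periodic orbit of period two of curves), and $T$ does not have any invariant curve.
   Context: $\mathbb{S}^1=\mathbb{R}/\mathbb{Z}$ and $R_\omega(\theta)=\theta+\omega \pmod 1$. $\mathcal{S}(\Omega)$ is the class of all maps $F:\Omega\to\Omega$ of the form $F(\theta,x)=(R_\omega(\theta),\zeta(\theta,x))$ with $\zeta:\mathbb{S}^1\times\mathbb{I}\to\mathbb{I}$ continuous (in both variables jointly). The upper and lower circles of $\Omega$ are $\mathbb{S}^1\times\{b\}$ and $\mathbb{S}^1\times\{a\}$. A curve is the graph $\{(\theta,\xi(\theta)):\theta\in\mathbb{S}^1\}\subset\Omega$ of a continuous map $\xi:\mathbb{S}^1\to\mathbb{I}$. A set $A\subset\Omega$ is $F$-invariant if $F(A)\subset A$; an invariant curve of $T$ is a curve that is a $T$-invariant set. *)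

(* Defs.v *)
From HB Require Import structures.
From mathcomp Require Import all_boot all_order all_algebra generic_quotient.
From mathcomp Require Import all_classical all_reals all_analysis.
Import Order.TTheory GRing.Theory Num.Theory.
Import numFieldNormedType.Exports.

Set Implicit Arguments.
Unset Strict Implicit.
Unset Printing Implicit Defensive.

Local Open Scope classical_set_scope.
Local Open Scope ring_scope.

Definition eqmodZ (R : realType) : rel R := fun x y => x - y \is a Num.int.

Lemma eqmodZ_refl (R : realType) : reflexive (@eqmodZ R).
Proof. by move=> x; rewrite /eqmodZ subrr rpred0. Qed.

Lemma eqmodZ_sym (R : realType) : symmetric (@eqmodZ R).
Proof. by move=> x y; rewrite /eqmodZ -opprB rpredN. Qed.

Lemma eqmodZ_trans (R : realType) : transitive (@eqmodZ R).
Proof.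
move=> y x z; rewrite /eqmodZ => xy yz.
by rewrite -(subrK y x) -addrA rpredD.
Qed.

Canonical eqmodZ_equiv (R : realType) :=
  EquivRel (@eqmodZ R) (@eqmodZ_refl R) (@eqmodZ_sym R) (@eqmodZ_trans R).

Notation circle R := (quotient_topology {eq_quot (@eqmodZ R)}%qT).

Definition circle_pi (R : realType) (x : R) : circle R :=
  (\pi_(circle R) x)%qT.

(* The value does not depend on the representative: see rotation_pi. *)
Definition rotation (R : realType) (omega : R) (theta : circle R) : circle R :=
  circle_pi (repr theta + omega).

Lemma circle_piP (R : realType) (x y : R) :
  circle_pi x = circle_pi y <-> x - y \is a Num.int.
Proof. exact: (rwP (@eqmodP _ (eqmodZ_equiv R) x y)). Qed.

Lemma rotation_pi (R : realType) (omega x : R) :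
  rotation omega (circle_pi x) = circle_pi (x + omega).
Proof.
apply/circle_piP; rewrite opprD addrACA subrr addr0.
by apply/circle_piP; rewrite /circle_pi reprK.
Qed.

(* The interval as a type, with the subspace topology; the annulus carries the
   product topology. *)
Notation segment a b := (set_type `[a, b]%classic).
Notation annulus R a b := (circle R * segment a b)%type.

Definition skew_product (R : realType) (omega a b : R)
    (F : annulus R a b -> annulus R a b) : Prop :=
  exists2 zeta : annulus R a b -> segment a b, continuous zeta &
    forall theta x, F (theta, x) = (rotation omega theta, zeta (theta, x)).

Definition upper_circle (R : realType) (a b : R) : set (annulus R a b) :=
  [set p | \val p.2 = b].

Definition lower_circle (R : realType) (a b : R) : set (annulus R a b) :=
  [set p | \val p.2 = a].

Definition is_curve (R : realType) (a b : R) (A : set (annulus R a b)) : Prop :=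
  exists2 xi : circle R -> segment a b, continuous xi &
    A = range (fun theta => (theta, xi theta)).

Definition invariant_set (X : Type) (F : X -> X) (A : set X) : Prop :=
  F @` A `<=` A.

Definition period2_curve (R : realType) (a b : R)
    (F : annulus R a b -> annulus R a b) (A : set (annulus R a b)) : Prop :=
  [/\ is_curve A, is_curve (F @` A), A `&` F @` A = set0 &
      F @` (F @` A) = A].

(* Main.v *)
(* In the coordinate t = (x - a) / (b - x), which identifies [a, b] with
   [0, +oo], take the fiber maps t |-> c(theta) / t with c = exp h.  An
   invariant curve cannot touch the boundary: otherwise it would alternate
   between the two circles along an orbit, while n * omega is arbitrarily close
   to the integers for suitable odd n.  So its logarithm is a bounded solution
   xi of the twisted cohomological equation xi(x + omega) + xi(x) = h(x).

   The lacunary series h(x) = sum_j 2^-(j+1) cos(2 pi k_j x), where k_j * omega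
   is extremely close to 1/2 modulo 1, admits no such solution.  Consider
     E_N(h) = sum_(m, n < N) (-1)^(n+m) h((n - m) omega).
   If xi existed, the inner sums would telescope and E_N(h) = O(N).  But each
   cosine contributes |sum_(n < N) (-1)^n exp(2 pi i k_j n omega)|^2 >= 0, and
   for N = 4^j the j-th one contributes at least 2^-(j+1) (N / 2)^2. *)
Require Import Defs.
From HB Require Import structures.
From mathcomp Require Import all_boot all_order all_algebra generic_quotient.
From mathcomp Require Import all_classical all_reals all_analysis.
From mathcomp Require Import zify ring lra.
Import Order.TTheory GRing.Theory Num.Theory.
Import numFieldNormedType.Exports.

Local Open Scope classical_set_scope.
Local Open Scope ring_scope.

(** * Diophantine approximation by multiples of an irrational number *)

Lemma irrational_lin_neq0 (R : realType) (omega : R) (n : nat) (p : int) :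
  irrational omega -> (0 < n)%N -> n%:R * omega - p%:~R != 0.
Proof.
move=> iw n0; apply/eqP => /subr0_eq e; apply: iw; apply/rationalP.
by exists p, n; rewrite -e mulrAC divff ?mul1r// pnatr_eq0 -lt0n.
Qed.

(** Pigeonhole: two of the fractional parts of [i * omega], [0 <= i <= N], fall in the same one of
    [N] boxes of length [1 / N]. Irrationality keeps their difference nonzero. *)
Lemma irrational_dirichlet {R : realType} (omega : R) (N : nat) :
  irrational omega -> (0 < N)%N ->
  exists (n : nat) (p : int),
    0 < `|n%:R * omega - p%:~R| < N%:R^-1.
Proof.
case: N => // N iw _.
pose fr (i : 'I_N.+2) : R := i%:R * omega - (Num.floor (i%:R * omega))%:~R.
have fr0 i : 0 <= fr i by rewrite subr_ge0 floor_le.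
have fr1 i : fr i < 1.
  by rewrite ltrBlDr addrC -intrD1 floorD1_gt.
have N0 : 0 < N.+1%:R :> R by rewrite ltr0n.
have bx i : (Num.truncn (N.+1%:R * fr i) < N.+1)%N.
  by rewrite truncn_lt_nat ?mulr_ge0// gtr_pMr.
pose box (i : 'I_N.+2) : 'I_N.+1 := Ordinal (bx i).
have /injectivePn[i [j ij /(congr1 val) /= bij]] : ~~ injectiveb box.
  apply/negP => /injectiveP/leq_card; by rewrite !card_ord ltnn.
wlog lij : i j ij bij / (j < i)%N.
  move=> H; have := ij; rewrite -val_eqE neq_ltn => /orP[|] lt.
    by apply: (H j i); rewrite // eq_sym.
  exact: (H i j).
exists (i - j)%N, (Num.floor (i%:R * omega) - Num.floor (j%:R * omega)).
rewrite normr_gt0 irrational_lin_neq0 ?subn_gt0//=.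
have -> : (i - j)%:R * omega -
    (Num.floor (i%:R * omega) - Num.floor (j%:R * omega))%:~R
  = fr i - fr j.
  rewrite /fr natrB; last exact: ltnW.
  by rewrite rmorphB /=; ring.
have key k : (Num.truncn (N.+1%:R * fr k))%:R <= N.+1%:R * fr k <
    (Num.truncn (N.+1%:R * fr k))%:R + 1.
  by rewrite natr1 truncn_itv// mulr_ge0.
have := key i; have := key j; rewrite bij => /andP[a1 a2] /andP[b1 b2].
rewrite -(ltr_pM2l N0) mulfV ?gt_eqF// -[X in X * _](gtr0_norm N0) -normrM mulrBr.
by rewrite ltr_norml; apply/andP; split; lra.
Qed.

(** A Dirichlet step [g] shorter than [e], multiplied by the floor of [x / g], ends within [|g|] of
    [x]. *)
Lemma irrational_dense {R : realType} (omega x e : R) :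
  irrational omega -> 0 < e ->
  exists k p : int, `|k%:~R * omega - p%:~R - x| < e.
Proof.
move=> iw e0.
have [|n [p /andP[g0 gN]]] := @irrational_dirichlet R omega (Num.truncn e^-1).+1 iw => //.
have ge : `|n%:R * omega - p%:~R| < e.
  apply: (lt_trans gN); rewrite invf_plt ?posrE ?ltr0n//.
  by rewrite truncnS_gt.
set g := n%:R * omega - p%:~R in g0 ge gN.
have gn0 : g != 0 by rewrite -normr_gt0.
exists (Num.floor (x / g) * n%:Z), (Num.floor (x / g) * p).
apply: le_lt_trans ge.
have -> : (Num.floor (x / g) * n)%:~R * omega - (Num.floor (x / g) * p)%:~R - x
   = ((Num.floor (x / g))%:~R - x / g) * g.
  rewrite !rmorphM /= mulrBl divfK// /g -pmulrn; ring.
rewrite normrM -[leRHS]mul1r ler_wpM2r//.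
have := floor_le (x / g); have := floorD1_gt (x / g); rewrite intrD1 => h1 h2.
by rewrite ler_norml; apply/andP; split; lra.
Qed.

(** * Periodicity of the cosine and series with a geometric bound *)

Lemma cosD2piz (R : realType) (x : R) (z : int) : cos (x + 2 * pi * z%:~R) = cos x.
Proof.
have nat_case (n : nat) (y : R) : cos (y + 2 * pi * n%:R) = cos y.
  rewrite -[RHS](periodicn (@cosD2pi R) n) mulr_natr mulr_natl; congr cos; ring.
case: z => n; first exact: nat_case.
by rewrite NegzE -[LHS](nat_case n.+1) mulrNz mulrN subrK.
Qed.

(** The tail is at most the sum of [2^-(j+1)] over [j >= n], which is [2^-n]. This explicit rate
    serves both the continuity of [h] and its truncation. *)
Lemma dominated_series_limit {R : realType} (v : nat -> R) :
  (forall j, `|v j| <= 2^-1 ^+ j.+1) ->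
  forall n, `|lim (series v @ \oo) - series v n| <= 2^-1 ^+ n.
Proof.
move=> vb n.
have geo m : \sum_(n <= j < n + m) 2^-1 ^+ j.+1 <= 2^-1 ^+ n :> R.
  suff -> : \sum_(n <= j < n + m) 2^-1 ^+ j.+1 = 2^-1 ^+ n - 2^-1 ^+ (n + m) :> R.
    by rewrite gerBl exprn_ge0.
  elim: m => [|m IH]; first by rewrite addn0 subrr big_geq.
  by rewrite addnS big_nat_recr ?leq_addr//= IH !exprS; lra.
have cv : cvgn (series v).
  apply: normed_cvg; apply: (series_le_cvg _ _ vb) => //.
  rewrite (_ : (fun _ => _) = geometric 2^-1 2^-1); last first.
    by apply/funext => k; rewrite exprS.
  by apply: is_cvg_geometric_series; rewrite ger0_norm//; lra.
have : (fun m => `|series v m - series v n|) @ \oo --> `|lim (series v @ \oo) - series v n|.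
  by apply: cvg_norm; apply: cvgB => //; exact: cvg_cst.
move=> /cvg_lim <- //.
apply: limr_le; first by apply: is_cvg_norm; apply: is_cvgB => //; exact: is_cvg_cst.
near=> m.
have nm : (n <= m)%N by near: m; exact: nbhs_infty_ge.
rewrite sub_series_geq// -(subnKC nm).
rewrite (le_trans _ (geo (m - n)%N))//.
by rewrite (le_trans (ler_norm_sum _ _ _))// ler_sum.
Unshelve. all: end_near. Qed.

(** * The alternating double sum [E_N], its argument counted in units of [omega] *)

Definition alternating_form {R : realType} (N : nat) (g : R -> R) : R :=
  \sum_(m < N) \sum_(n < N) (-1) ^+ (n + m) * g (n%:R - m%:R).

Lemma alternating_formB {R : realType} N (g1 g2 : R -> R) :
  alternating_form N (fun s => g1 s - g2 s) =
  alternating_form N g1 - alternating_form N g2.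
Proof.
rewrite /alternating_form -sumrB; apply: eq_bigr => m _.
by rewrite -sumrB; apply: eq_bigr => n _; rewrite mulrBr.
Qed.

Lemma alternating_form_sum {R : realType} N (J : nat) (c : nat -> R) (g : nat -> R -> R) :
  alternating_form N (fun s => \sum_(0 <= j < J) c j * g j s) =
  \sum_(0 <= j < J) c j * alternating_form N (g j).
Proof.
rewrite /alternating_form.
under [RHS]eq_bigr do rewrite mulr_sumr.
rewrite [RHS]exchange_big /=; apply: eq_bigr => m _.
under [RHS]eq_bigr do rewrite mulr_sumr.
rewrite [RHS]exchange_big /=; apply: eq_bigr => n _.
by rewrite mulr_sumr; apply: eq_bigr => j _; rewrite mulrCA.
Qed.

Lemma alternating_form_bound {R : realType} N (g : R -> R) (C : R) :
  (forall s, `|g s| <= C) -> `|alternating_form N g| <= N%:R ^+ 2 * C.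
Proof.
move=> gC.
have -> : N%:R ^+ 2 * C = \sum_(m < N) \sum_(n < N) C.
  by rewrite !sumr_const !card_ord -mulrnA -[RHS]mulr_natl natrM expr2.
rewrite (le_trans (ler_norm_sum _ _ _))// ler_sum// => m _.
rewrite (le_trans (ler_norm_sum _ _ _))// ler_sum// => n _.
by rewrite normrM normrX normrN1 expr1n mul1r.
Qed.

Lemma alternating_sum_telescope {R : realType} N (u : nat -> R) :
  \sum_(n < N) (-1) ^+ n * (u n.+1 + u n) = u 0%N - (-1) ^+ N * u N.
Proof.
elim: N => [|N IH]; first by rewrite big_ord0 expr0 mul1r subrr.
by rewrite big_ord_recr /= IH exprS; ring.
Qed.

(** For fixed [m] the sum over [n] telescopes to two boundary terms, so each of the [N] rows costs
    at most [2 * M]. *)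
Lemma alternating_form_coboundary {R : realType} N (u : R -> R) (M : R) :
  (forall s, `|u s| <= M) ->
  `|alternating_form N (fun s => u (s + 1) + u s)| <= N%:R * (2 * M).
Proof.
move=> uM.
have -> : N%:R * (2 * M) = \sum_(m < N) (2 * M) by rewrite sumr_const card_ord mulr_natl.
rewrite (le_trans (ler_norm_sum _ _ _))// ler_sum// => m _.
under eq_bigr => n _ do rewrite exprD mulrAC [X in X * _]mulrC addrAC natr1.
rewrite [X in `|X|](_ : _ = (-1) ^+ m *
    \sum_(n < N) (-1) ^+ n * (u (n.+1%:R - m%:R) + u (n%:R - m%:R))); last first.
  by rewrite mulr_sumr; apply: eq_bigr => n _; ring.
rewrite (alternating_sum_telescope N (fun n => u (n%:R - m%:R))).
rewrite normrM normrX normrN1 expr1n mul1r (le_trans (ler_normB _ _))//.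
by rewrite normrM normrX normrN1 expr1n mul1r mulr2n mulrDl mul1r lerD.
Qed.

(* The right-hand side is |sum_(n < N) (-1)^n exp(i y n)|^2. *)
Lemma alternating_form_cos {R : realType} N (y : R) :
  alternating_form N (fun s => cos (y * s)) =
  (\sum_(n < N) (-1) ^+ n * cos (y * n%:R)) ^+ 2 +
  (\sum_(n < N) (-1) ^+ n * sin (y * n%:R)) ^+ 2.
Proof.
rewrite !expr2 !mulr_suml -big_split /=; apply: eq_bigr => m _.
rewrite !mulr_sumr -big_split /=; apply: eq_bigr => n _.
by rewrite mulrBr cosB exprD; ring.
Qed.

(** * The lacunary series and the twisted cohomological equation *)

Lemma cos_near0 (R : realType) : exists2 d : R, 0 < d & forall x, `|x| < d -> 2^-1 <= cos x.
Proof.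
have /cvgrPdist_lt/(_ 2^-1)/= := @continuous_cos R 0.
rewrite invr_gt0 ltr0n => /(_ isT) /nbhs_ballP[d /= d0 dP].
exists d => // x xd; have := dP x.
rewrite /ball/= sub0r normrN cos0 => /(_ xd).
by rewrite ltr_norml => /andP[_]; lra.
Qed.

(** Take [k * omega] close to [1 / 2] modulo 1. The angle is then close to [pi * n] modulo [2 * pi],
    and the sign turns the cosine into that of a small angle. *)
Lemma cos_alternating_frequency {R : realType} (omega : R) (N : nat) :
  irrational omega ->
  exists k : int, forall n, (n < N)%N ->
    2^-1 <= (-1) ^+ n * cos (2 * pi * k%:~R * omega * n%:R).
Proof.
move=> iw; have [d d0 dP] := cos_near0 R.
have pi0 := pi_gt0 R.
(* The error in [k * omega] gets multiplied by [2 * pi * n] with [n < N] and has to stay below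
   [d]. *)
have e0 : 0 < d / (2 * pi * N.+1%:R) by rewrite divr_gt0// !mulr_gt0.
have [k [p kp]] := irrational_dense omega 2^-1 _ iw e0.
exists k => n nN.
set g := k%:~R * omega - p%:~R - 2^-1 in kp.
have -> : 2 * pi * k%:~R * omega * n%:R =
  2 * pi * g * n%:R + pi *+ n + 2 * pi * (p * n%:Z)%:~R.
  by rewrite rmorphM /= -pmulrn /g -[pi *+ n]mulr_natr; field.
rewrite cosD2piz (alternatingn (@cosDpi R)) mulrA -exprMn mulrNN mulr1 expr1n mul1r.
apply: dP; rewrite !normrM [ `|pi|]gtr0_norm// !normr_nat.
move: kp; rewrite ltr_pdivlMr ?mulr_gt0// => kp.
apply: le_lt_trans kp; rewrite mulrA [2 * pi * `|g|]mulrC ler_wpM2l//.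
  by rewrite !mulr_ge0// ltW.
by rewrite ler_nat leqW// ltnW.
Qed.

Lemma dominated_series_continuous {R : realType} (u : nat -> R -> R) :
  (forall j, continuous (u j)) -> (forall j x, `|u j x| <= 2^-1 ^+ j.+1) ->
  continuous (fun x => lim (series (u ^~ x) @ \oo)).
Proof.
move=> uc ub x; apply/cvgrPdist_le => e e0.
have [n ne] : exists n, 2^-1 ^+ n <= e / 3.
  have : (fun n => 2^-1 ^+ n) @ \oo --> (0 : R).
    by apply: cvg_expr; rewrite ger0_norm//; lra.
  move=> /cvgrPdist_le/(_ (e / 3)); rewrite divr_gt0// => /(_ isT)[n _ /(_ n)].
  rewrite /= sub0r normrN => /(_ (leqnn n)) h; exists n.
  by rewrite (le_trans _ h)// ler_norm.
have sc : {for x, continuous (fun y => series (u ^~ y) n)}.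
  by apply: cvg_big => [|j _]; [exact: add_continuous|exact: uc].
move/cvgrPdist_le : sc => /(_ (e / 3)); rewrite divr_gt0// => /(_ isT).
apply: filterS => y /= sxy.
have hx := dominated_series_limit (u ^~ x) (ub ^~ x) n.
have hy := dominated_series_limit (u ^~ y) (ub ^~ y) n.
move: sxy hx hy ne; rewrite !ler_norml => /andP[a1 a2] /andP[b1 b2] /andP[c1 c2] d.
by apply/andP; split; lra.
Qed.

(** For [N = 4^j] the upper bound on the double sum has order [N], the lower bound order
    [2^-j * N^2 = N^(3/2)]. *)
Lemma twisted_coboundary_unsolvable {R : realType} (omega : R) :
  irrational omega ->
  exists2 h : R -> R, continuous h /\ (forall x (z : int), h (x + z%:~R) = h x) &
  forall (xi : R -> R) (M : R), (forall x, `|xi x| <= M) ->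
    ~ (forall x, xi (x + omega) + xi x = h x).
Proof.
move=> iw.
have [k kP] := choice (fun j => cos_alternating_frequency omega (4 ^ j) iw).
pose u (j : nat) (x : R) := 2^-1 ^+ j.+1 * cos (2 * pi * (k j)%:~R * x).
have ub j x : `|u j x| <= 2^-1 ^+ j.+1.
  by rewrite normrM ger0_norm ?exprn_ge0// ler_piMr ?exprn_ge0// cos_max.
exists (fun x => lim (series (u ^~ x) @ \oo)) => [|xi M xiM xiP].
  split=> [|x z].
    apply: dominated_series_continuous => // j x.
    apply: cvgM; first exact: cvg_cst.
    apply: continuous_comp; last exact: continuous_cos.
    by apply: cvgM; [exact: cvg_cst|exact: cvg_id].
  congr (lim (series _ @ \oo)); apply/funext => j; rewrite /u; congr (_ * _).
  rewrite -[RHS](cosD2piz R _ (k j * z)); congr cos.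
  by rewrite rmorphM /=; ring.
pose h x := lim (series (u ^~ x) @ \oo).
have {}xiP x : xi (x + omega) + xi x = h x := xiP x.
have M0 : 0 <= M := le_trans (normr_ge0 _) (xiM 0).
(* With [q = 2^j] the bounds will combine to [q^3 / 8 <= 2 * M * q^2 + 1]. This fails once
   [16 * M + 8 < q], which follows from [j + 1 <= 2^j]. *)
pose j := Num.truncn (16 * M + 8).
have jM : 16 * M + 8 < j.+1%:R by rewrite truncnS_gt.
(* Cutting the series after [n] terms changes the double sum by at most [N^2 * 2^-n = 1/2], and
   [j < n] keeps the [j]-th cosine. *)
pose N := (4 ^ j)%N; pose n := (4 * j).+1.
have upper : alternating_form N (fun s => h (s * omega)) <= N%:R * (2 * M).
  rewrite (le_trans (ler_norm _))//.
  rewrite (_ : (fun s => _) = fun s => xi ((s + 1) * omega) + xi (s * omega)).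
    exact: (alternating_form_coboundary N (fun s => xi (s * omega))).
  by apply/funext => s; rewrite -xiP mulrDl mul1r.
have error : alternating_form N (fun s => series (u ^~ (s * omega)) n)
    - alternating_form N (fun s => h (s * omega)) <= 1.
  rewrite -alternating_formB (le_trans (ler_norm _))//.
  have := @alternating_form_bound R N _ (2^-1 ^+ n)
    (fun s : R => _ : `|series (u ^~ (s * omega)) n - h (s * omega)| <= _).
  move=> /(_ _)/le_trans; apply.
    by move=> s; rewrite distrC; exact: dominated_series_limit.
  have -> : N%:R ^+ 2 = 16 ^+ j :> R by rewrite natrX -exprM mulnC exprM -natrX.
  have -> : 2^-1 ^+ n = 2^-1 * 16^-1 ^+ j :> R.
    by rewrite exprS exprM; congr (_ * _ ^+ _); field.
  by rewrite mulrCA -exprMn mulfV// expr1n; lra.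
have lower : 2^-1 ^+ j.+1 * (N%:R / 2) ^+ 2 <=
    alternating_form N (fun s => series (u ^~ (s * omega)) n).
  rewrite /series/= alternating_form_sum.
  (* Every cosine contributes a sum of two squares. For [i = j] the first square is that of a sum of
     [N] terms, each at least [1/2]. *)
  have pos i : (N%:R / 2) ^+ 2 * (i == j)%:R <=
      alternating_form N (fun s => cos (2 * pi * (k i)%:~R * (s * omega))).
    under [X in alternating_form _ X]eq_fun do rewrite [_ * omega]mulrC mulrA.
    rewrite alternating_form_cos; case: eqP => [->|_]; last first.
      by rewrite mulr0 addr_ge0// sqr_ge0.
    rewrite mulr1 ler_wpDr ?sqr_ge0// ler_sqr ?nnegrE ?divr_ge0//; last first.
      by apply: sumr_ge0 => i' _; rewrite (le_trans _ (kP j i' _)).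
    rewrite mulr_natl -[N in leLHS]card_ord -sumr_const ler_sum// => i' _.
    exact: kP.
  have jn : (j < n)%N by rewrite ltnS leq_pmull.
  rewrite (big_cat_nat _ (n := j))//=; last exact: ltnW.
  rewrite [X in _ + X]big_ltn// addrCA ler_wpDr//.
    by rewrite addr_ge0//; apply: sumr_ge0 => i _;
      rewrite mulr_ge0 ?exprn_ge0// (le_trans _ (pos i))// mulr_ge0 ?sqr_ge0.
  by rewrite ler_wpM2l ?exprn_ge0// (le_trans _ (pos j))// eqxx mulr1.
pose q : R := 2 ^+ j.
have q0 : 0 < q by rewrite exprn_gt0.
have qj : j.+1%:R <= q by rewrite /q -natrX ler_nat ltn_expl.
have Nq : N%:R = q ^+ 2 by rewrite /N /q natrX -exprM mulnC exprM -(natrX _ 2 2).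
move: upper error lower; rewrite exprVn exprS -/q Nq => h1 h2 h3.
have : (2 * q)^-1 * (q ^+ 2 / 2) ^+ 2 <= q ^+ 2 * (2 * M) + 1 by lra.
have -> : (2 * q)^-1 * (q ^+ 2 / 2) ^+ 2 = q ^+ 3 / 8 by field; rewrite gt_eqF.
have q1 : 1 <= q by rewrite exprn_ege1// ler1n.
have qq : q ^+ 2 * (16 * M + 8) < q ^+ 2 * q by rewrite ltr_pM2l ?exprn_gt0// (lt_le_trans jM).
have q2 : 1 <= q ^+ 2 by rewrite exprn_ege1.
rewrite exprSr; lra.
Qed.

(** * Periodic functions on the line as functions on the circle *)

Lemma circle_pi_continuous (R : realType) : continuous (@circle_pi R).
Proof. exact: pi_continuous. Qed.

Lemma circle_piK {R : realType} (theta : circle R) : circle_pi (repr theta) = theta.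
Proof. by rewrite /circle_pi reprK. Qed.

Lemma circle_piDz (R : realType) (x : R) (z : int) :
  circle_pi (x + z%:~R) = circle_pi x.
Proof. by apply/circle_piP; rewrite addrAC subrr add0r intr_int. Qed.

Section PeriodicLift.
Context {R : realType} (g : R -> R).
Hypothesis gz : forall x (z : int), g (x + z%:~R) = g x.

Lemma periodic_repr x : g (repr (circle_pi x)) = g x.
Proof.
have /circle_piP/intrP[z e] := circle_piK (circle_pi x).
by rewrite -(subrK x (repr _)) e addrC gz.
Qed.

(** Although [repr] need not be continuous, [g] is constant on classes and so descends to the
    quotient. *)
Lemma periodic_repr_continuous :
  continuous g -> continuous (fun theta : circle R => g (repr theta)).
Proof.
move=> gc; apply: repr_comp_continuous => // x y /eqP/circle_piP/intrP[z e].
by rewrite -(subrK y x) e addrC gz.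
Qed.

(** The extreme value theorem on [[0, 1]], to which subtracting the floor reduces any [x]. *)
Lemma periodic_continuous_bounded : continuous g -> exists M, forall x, `|g x| <= M.
Proof.
move=> gc.
have : {within `[0, 1], continuous (fun x => `|g x|)}.
  apply: continuous_subspaceT => x.
  by apply: continuous_comp; [exact: gc|exact: norm_continuous].
move=> /(EVT_max ler01)[c _ cM]; exists `|g c| => x.
rewrite -(gz x (- Num.floor x)) cM// in_itv/= rmorphN/= subr_ge0 floor_le/=.
by rewrite lerBlDr addrC -intrD1 ltW// floorD1_gt.
Qed.

End PeriodicLift.

(* In the coordinate t = (x - a) / (b - x) on [a, b] this is t |-> c / t. *)
Definition fiber_inversion {R : realType} (a b c x : R) : R :=
  a + (b - a) * (c * (b - x)) / (c * (b - x) + (x - a)).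

(** * The inversion of a fiber *)

Section FiberInversion.
Context {R : realType} (a b : R).
Hypothesis ab : a < b.
Variable c : R.
Hypothesis c0 : 0 < c.

(** Both summands are nonnegative and they vanish at opposite endpoints. *)
Lemma fiber_inversion_den x : a <= x <= b -> 0 < c * (b - x) + (x - a).
Proof.
move=> /andP[ax xb]; have [->|xneb] := eqVneq x b.
  by rewrite subrr mulr0 add0r subr_gt0.
by rewrite ltr_wpDr ?subr_ge0// mulr_gt0// subr_gt0 lt_neqAle xneb.
Qed.

Lemma fiber_inversion_itv x : a <= x <= b -> a <= fiber_inversion a b c x <= b.
Proof.
move=> axb; have d0 := fiber_inversion_den x axb; case/andP: axb => ax xb.
have n0 : 0 <= c * (b - x) by rewrite mulr_ge0 ?subr_ge0// ltW.
have s0 : 0 <= b - a by rewrite subr_ge0 ltW.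
apply/andP; split; first by rewrite lerDl; apply: divr_ge0; [exact: mulr_ge0|exact: ltW].
by rewrite -lerBrDl ler_pdivrMr// ler_wpM2l// lerDl subr_ge0.
Qed.

Lemma fiber_inversion_right : fiber_inversion a b c b = a.
Proof. by rewrite /fiber_inversion subrr !mulr0 mul0r addr0. Qed.

Lemma fiber_inversion_left : fiber_inversion a b c a = b.
Proof.
rewrite /fiber_inversion subrr addr0 mulfK ?subrKC//.
by rewrite gt_eqF// mulr_gt0// subr_gt0.
Qed.

Lemma fiber_inversion_anti x y : a <= x -> x <= y -> y <= b ->
  fiber_inversion a b c y <= fiber_inversion a b c x.
Proof.
move=> ax xy yb.
have dx : 0 < c * (b - x) + (x - a) by apply: fiber_inversion_den; rewrite ax (le_trans xy).
have dy : 0 < c * (b - y) + (y - a) by apply: fiber_inversion_den; rewrite yb (le_trans ax).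
rewrite /fiber_inversion lerD2l ler_pdivrMr// [leRHS]mulrAC ler_pdivlMr// -subr_ge0.
(* The terms in [c^2] cancel after cross-multiplication, and [(b - x) * (y - a) - (b - y) * (x - a)
   = (b - a) * (y - x)]. *)
rewrite [leRHS](_ : _ = c * ((b - a) ^+ 2 * (y - x))); last by ring.
by rewrite !mulr_ge0 ?sqr_ge0 ?subr_ge0// ltW.
Qed.

(** For [c = exp h], logarithms turn this into [L |-> h - L], the source of the twisted equation. *)
Lemma fiber_inversion_ratio x : a < x < b ->
  (fiber_inversion a b c x - a) / (b - fiber_inversion a b c x) =
  c / ((x - a) / (b - x)).
Proof.
move=> /andP[ax xb].
have xa : x - a != 0 by rewrite subr_eq0 gt_eqF.
have bx : b - x != 0 by rewrite subr_eq0 gt_eqF.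
have ba : b - a != 0 by rewrite subr_eq0 gt_eqF.
have d : c * (b - x) + (x - a) != 0.
  by rewrite gt_eqF// fiber_inversion_den// !ltW.
have -> : b - fiber_inversion a b c x = (b - a) * (x - a) / (c * (b - x) + (x - a)).
  by rewrite /fiber_inversion; field.
by rewrite /fiber_inversion; field; rewrite ba xa bx d.
Qed.

End FiberInversion.

(** * From an invariant function to a bounded solution *)

(** Doubling an approximation [k * omega - p] of [omega / 2] makes [(2 * k - 1) * omega - 2 * p]
    small, with an odd multiplier. *)
Lemma irrational_odd_multiple {R : realType} (omega d : R) :
  irrational omega -> 0 < d ->
  exists (n : nat) (p : int), odd n /\ `|n%:R * omega - p%:~R| < d.
Proof.
move=> iw d0.
have d20 : 0 < d / 2 by lra.
have [k [p kp]] := irrational_dense omega (omega / 2) _ iw d20.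
have {kp} : `|(2%:Z * k - 1)%:~R * omega - (2%:Z * p)%:~R| < d.
  have -> : (2%:Z * k - 1)%:~R * omega - (2%:Z * p)%:~R
    = 2 * (k%:~R * omega - p%:~R - omega / 2).
    by rewrite rmorphB !rmorphM /=; field.
  by rewrite normrM normr_nat; lra.
have oddz : odd (absz (2%:Z * k - 1)%R).
  by lia.
(* A negative multiplier is replaced by its opposite, as is the integer next to it. *)
case: (2%:Z * k - 1) oddz => n /= on np; first by exists n, (2%:Z * p).
exists n.+1, (- (2%:Z * p)); split=> //.
move: np; rewrite -normrN NegzE; congr (`|_| < d).
by rewrite !rmorphN/= -pmulrn; ring.
Qed.

Section NoInvariantFunction.
Context {R : realType} (omega a b : R) (h xi : R -> R).
Hypotheses (iw : irrational omega) (ab : a < b).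
Hypotheses (xic : continuous xi) (xiz : forall x (z : int), xi (x + z%:~R) = xi x).
Hypothesis xiab : forall x, a <= xi x <= b.
Hypothesis xiP : forall x, xi (x + omega) = fiber_inversion a b (expR (h x)) (xi x).

Lemma invariant_alternates (n : nat) x :
  xi x = b -> xi (x + n%:R * omega) = if odd n then a else b.
Proof.
move=> xb; elim: n => [|n IH]; first by rewrite mul0r addr0.
rewrite -natr1 mulrDl mul1r addrA xiP IH /=; case: odd => /=.
  by rewrite fiber_inversion_left ?expR_gt0.
exact: fiber_inversion_right.
Qed.

(** An odd number of rotations can return arbitrarily close to [x] modulo 1, yet it sends the value
    [b] to [a]. This jump of [b - a] contradicts continuity. *)
Lemma invariant_neq_right x : xi x != b.
Proof.
apply/eqP => xb; have ba0 : 0 < b - a by rewrite subr_gt0.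
have /cvgrPdist_lt/(_ _ ba0) := xic x.
move=> /nbhs_ballP[d /= d0 dP].
have [n [p [on np]]] := irrational_odd_multiple omega d iw d0.
have := dP (x + n%:R * omega + (- p)%:~R); rewrite /ball/= xiz.
rewrite invariant_alternates// on xb (gtr0_norm ba0) ltxx.
move=> nf; suff : false by []; apply: nf.
rewrite rmorphN/= -addrA opprD addrA subrr add0r normrN.
exact: np.
Qed.

Lemma invariant_neq_left x : xi x != a.
Proof.
apply/eqP => xa; have := invariant_neq_right (x + omega).
by rewrite xiP xa fiber_inversion_left ?expR_gt0// eqxx.
Qed.

(** [L] is the logarithm of the coordinate [t] along the curve. It is finite because the curve
    avoids both endpoints, and bounded because it is continuous and periodic. *)
Lemma invariant_log_solution : exists (L : R -> R) (M : R),
  (forall x, `|L x| <= M) /\ (forall x, L (x + omega) + L x = h x).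
Proof.
have xio x : a < xi x < b.
  have /andP[ax xb] := xiab x; rewrite !lt_neqAle ax xb !andbT.
  by rewrite eq_sym invariant_neq_left invariant_neq_right.
have bx x : 0 < b - xi x by rewrite subr_gt0; case/andP: (xio x).
have r0 x : 0 < (xi x - a) / (b - xi x).
  by rewrite divr_gt0// subr_gt0; case/andP: (xio x).
pose L x := ln ((xi x - a) / (b - xi x)).
have Lc : continuous L.
  move=> x; apply: (@continuous_comp _ _ _ (fun x => (xi x - a) / (b - xi x)) (@ln R));
    last exact: continuous_ln.
  apply: cvgM; first by apply: cvgB; [exact: xic|exact: cvg_cst].
  apply: cvgV; first by rewrite gt_eqF.
  by apply: cvgB; [exact: cvg_cst|exact: xic].
have [|M LM] := periodic_continuous_bounded L _ Lc.
  by move=> x z; rewrite /L xiz.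
exists L, M; split=> // x.
rewrite /L xiP fiber_inversion_ratio ?expR_gt0//.
by rewrite ln_div ?posrE ?expR_gt0// expRK subrK.
Qed.

End NoInvariantFunction.

(** * The skew product on the annulus *)

Lemma rotation_surjective (R : realType) (omega : R) (theta : circle R) :
  exists theta', rotation omega theta' = theta.
Proof.
by exists (circle_pi (repr theta - omega)); rewrite rotation_pi subrK circle_piK.
Qed.

Section Skew.
Context {R : realType} (omega a b : R) (h : R -> R).
Hypothesis ab : a < b.

Lemma segment_itv (x : segment a b) : a <= \val x <= b.
Proof. by have := valP x; rewrite inE/= in_itv. Qed.

Lemma fiber_map_subproof (p : annulus R a b) :
  fiber_inversion a b (expR (h (repr p.1))) (\val p.2) \in `[a, b]%classic.
Proof.
by rewrite inE/= in_itv/= fiber_inversion_itv// ?expR_gt0// segment_itv.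
Qed.

Definition fiber_map (p : annulus R a b) : segment a b := SigSub (fiber_map_subproof p).

Lemma fiber_map_continuous : continuous h ->
  (forall x (z : int), h (x + z%:~R) = h x) -> continuous fiber_map.
Proof.
(* The segment carries the subspace topology, so continuity is checked on the real value. *)
move=> hc hz; apply: continuous_comp_initial => p.
have cc : {for p, continuous (fun p : annulus R a b => expR (h (repr p.1)))}.
  apply: (@continuous_comp _ _ _ (fun p : annulus R a b => h (repr p.1)));
    last exact: continuous_expR.
  apply: (@continuous_comp _ _ _ (fun p : annulus R a b => p.1)
    (fun th => h (repr th))).
    exact: cvg_fst.
  exact: periodic_repr_continuous.
have cx : {for p, continuous (fun p : annulus R a b => \val p.2 : R)}.
  apply: (@continuous_comp _ _ _ (fun p : annulus R a b => p.2)
    (fun x : segment a b => \val x : R)).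
    exact: cvg_snd.
  exact: initial_continuous.
have cbx : {for p, continuous
    (fun p : annulus R a b => expR (h (repr p.1)) * (b - \val p.2))}.
  by apply: cvgM => //; apply: cvgB => //; exact: cvg_cst.
apply: cvgD; first exact: cvg_cst.
apply: cvgM; first by apply: cvgM; [exact: cvg_cst|].
apply: cvgV.
  by rewrite gt_eqF// fiber_inversion_den ?expR_gt0// segment_itv.
by apply: cvgD => //; apply: cvgB => //; exact: cvg_cst.
Qed.

End Skew.

Theorem theorem1 (R : realType) (omega a b : R)
  (homega : irrational omega) (hab : a < b) :
  exists (T : annulus R a b -> annulus R a b) (f : annulus R a b -> segment a b),
    skew_product omega T /\
    (forall theta x, T (theta, x) = (rotation omega theta, f (theta, x))) /\
    (forall theta (x y : segment a b), \val x <= \val y ->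
       \val (f (theta, y)) <= \val (f (theta, x))) /\
    (T @` @upper_circle R a b = @lower_circle R a b /\
     T @` @lower_circle R a b = @upper_circle R a b) /\
    (forall theta (x : segment a b), \val x = b -> \val (f (theta, x)) = a) /\
    (forall theta (x : segment a b), \val x = a -> \val (f (theta, x)) = b) /\
    (exists A : set (annulus R a b), period2_curve T A) /\
    ~ (exists A : set (annulus R a b), is_curve A /\ invariant_set T A).
Proof.
have [h [hc hz] hP] := twisted_coboundary_unsolvable omega homega.
pose f := fiber_map a b h hab.
pose T (p : annulus R a b) := (rotation omega p.1, f p).
have fb theta (x : segment a b) : \val x = b -> \val (f (theta, x)) = a.
  by move=> /= ->; exact: fiber_inversion_right.
have fa theta (x : segment a b) : \val x = a -> \val (f (theta, x)) = b.
  by move=> /= ->; rewrite fiber_inversion_left ?expR_gt0.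
have bab : b \in `[a, b]%classic by rewrite inE/= in_itv/= lexx ltW.
have aab : a \in `[a, b]%classic by rewrite inE/= in_itv/= lexx ltW.
pose top : segment a b := SigSub bab.
pose bot : segment a b := SigSub aab.
have Tup : T @` @upper_circle R a b = @lower_circle R a b.
  apply/seteqP; split=> [_ [[th x] /= xb <-]|[th x] /= xa]; first exact: fb.
  (* A preimage under the rotation shows that the image fills the whole lower circle. *)
  have [th' th'P] := rotation_surjective _ omega th.
  exists (th', top) => //; rewrite /T /= th'P; congr pair.
  by apply: val_inj; rewrite fb.
have Tlo : T @` @lower_circle R a b = @upper_circle R a b.
  apply/seteqP; split=> [_ [[th x] /= xb <-]|[th x] /= xa]; first exact: fa.
  have [th' th'P] := rotation_surjective _ omega th.
  exists (th', bot) => //; rewrite /T /= th'P; congr pair.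
  by apply: val_inj; rewrite fa.
exists T, f; split; first by exists f => //; exact: fiber_map_continuous.
split=> //; split.
  move=> th x y xy; have /andP[ax _] := segment_itv _ _ x.
  have /andP[_ yb] := segment_itv _ _ y.
  by apply: fiber_inversion_anti; rewrite ?expR_gt0.
do 3 (split=> //); split.
  exists (@upper_circle R a b); split; rewrite ?Tup//.
  - exists (fun=> top) ; first exact: cst_continuous.
    apply/seteqP; split=> [[th x] /= xb|_ [th _ <-]//].
    by exists th => //; congr pair; apply: val_inj.
  - exists (fun=> bot) ; first exact: cst_continuous.
    apply/seteqP; split=> [[th x] /= xb|_ [th _ <-]//].
    by exists th => //; congr pair; apply: val_inj.
  - apply/seteqP; split=> // -[th x] [/= xb xa].
    by have := hab; rewrite -[ltLHS]xa -[ltRHS]xb ltxx.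
move=> [A [[xi xic ->] inv]].
(* By invariance [T (th, xi th)] lies on the graph again. Its first coordinate identifies the base
   point, its second gives the equation. *)
have xiP th : xi (rotation omega th) = f (th, xi th).
  have /= [th' _ [<- <-//]] :=
    inv (T (th, xi th)) (ex_intro2 _ _ _ (ex_intro2 _ _ th I erefl) erefl).
(* The lift of the curve to a function of period 1 on the line, where the logarithm argument
   applies. *)
pose g x := \val (xi (circle_pi x)).
have [] := @invariant_log_solution R omega a b h g homega hab.
- move=> x; apply: (@continuous_comp _ _ _ (fun x : R => xi (circle_pi x))
    (fun x : segment a b => \val x : R)).
    by apply: continuous_comp; [exact: circle_pi_continuous|exact: xic].
  exact: initial_continuous.
- by move=> x z; rewrite /g circle_piDz.
- by move=> x; exact: segment_itv.
- by move=> x; rewrite /g -rotation_pi xiP /= periodic_repr.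
by move=> L [M [LM Leq]]; exact: hP LM Leq.
Qed.
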